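(* Let $p>1$ and $q=p/(p-1)$. Let $r$ be a positive integer and let $Y_i$, $1\le i\le 2^r$, be real random variables in $\mathbf L^p$, adapted to an increasing filtration $(\mathcal F_i)_i$. Let $S_m=Y_1+\cdots+Y_m$ for $1\le m\le 2^r$. Then $$ \Bigl\|\max_{1\le i\le 2^r}|S_i|\Bigr\|_p\le q\|S_{2^r}\|_p+q\sum_{l=0}^{r-1}\Biggl(\sum_{k=1}^{2^{r-l}-1}\bigl\|\mathbf E\bigl(S_{(k+1)2^l}-S_{k2^l}\mid\mathcal F_{k2^l}\bigr)\bigr\|_p^p\Biggr)^{1/p}. $$
   Context: $\|\cdot\|_p$ denotes the norm in $\mathbf L^p$. Adapted means that $Y_i$ is $\mathcal F_i$-measurable for each $i$. No centering, stationarity or independence is assumed. *)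

(* Defs.v *)
From HB Require Import structures.
From mathcomp Require Import all_boot all_order all_algebra.
From mathcomp Require Import all_classical all_reals all_analysis.
From mathcomp Require Import measurable_realfun.

Set Implicit Arguments.
Unset Strict Implicit.
Unset Printing Implicit Defensive.

Import Order.TTheory GRing.Theory Num.Theory.
Import numFieldNormedType.Exports.

Local Open Scope classical_set_scope.
Local Open Scope ring_scope.

Definition is_sub_sigma_algebra d (T : measurableType d)
    (G : set (set T)) : Prop :=
  sigma_algebra [set: T] G /\ G `<=` measurable.

Definition is_filtration d (T : measurableType d)
    (F : nat -> set (set T)) : Prop :=
  (forall n, is_sub_sigma_algebra (F n)) /\
  (forall m n, (m <= n)%N -> F m `<=` F n).

(* When G is a sigma-algebra, the measurable sets of g_sigma_algebraType G are
   exactly the members of G. *)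
Definition measurable_wrt d (T : measurableType d) (R : realType)
    (G : set (set T)) (f : T -> R) : Prop :=
  @measurable_fun _ _ (g_sigma_algebraType G) R [set: T] f.

Definition is_cond_exp d (T : measurableType d) (R : realType)
    (P : probability T R) (G : set (set T)) (X Z : T -> R) : Prop :=
  [/\ measurable_wrt G Z,
      P.-integrable [set: T] (EFin \o Z) &
      forall A, G A ->
        (\int[P]_(x in A) (Z x)%:E = \int[P]_(x in A) (X x)%:E)%E].

(* The zero default is never used when X is integrable and G is a
   sub-sigma-algebra: see cond_expP. *)
Definition cond_exp d (T : measurableType d) (R : realType)
    (P : probability T R) (G : set (set T)) (X : T -> R) : T -> R :=
  xget (cst 0) [set Z | is_cond_exp P G X Z].

Definition partial_sum (T : Type) (R : realType) (Y : nat -> T -> R) (m : nat) :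
    T -> R :=
  fun w => \sum_(1 <= i < m.+1) Y i w.

Lemma sub_sigma_algebra_measurableE d (T : measurableType d) (G : set (set T)) :
  is_sub_sigma_algebra G -> G.-sigma.-measurable = G.
Proof. by move=> [sG _]; exact: sigma_algebra_id. Qed.

Lemma cond_exp_exists d (T : measurableType d) (R : realType)
    (P : probability T R) (G : set (set T)) (X : T -> R) :
  is_sub_sigma_algebra G -> P.-integrable [set: T] (EFin \o X) ->
  exists Z, is_cond_exp P G X Z.
Proof.
move=> sG iX; have mE := sub_sigma_algebra_measurableE sG.
pose T' := g_sigma_algebraType G.
have mid : measurable_fun [set: T] (id : T -> T').
  by move=> _ B mB; rewrite setTI preimage_id; apply: sG.2; rewrite -mE.
pose phi : {mfun T >-> T'} :=
  HB.pack (id : T -> T') (isMeasurableFun.Build _ _ _ _ _ mid).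
pose Q : probability T' R := distribution P phi.
have mX := measurable_int _ iX.
pose nu0 : {charge set T -> \bar R} := induced_charge iX.
pose mknu : {charge set T' -> \bar R} := pushforward nu0 phi.
pose nu := mknu mid.
have nuQ : nu `<< Q.
  apply/null_content_dominatesP => A mA QA0.
  have GA : measurable (A : set T) by apply: sG.2; rewrite -mE.
  apply: null_set_integral => //.
  by apply: (measurable_funS measurableT _ mX); exact: subsetT.
have fR x := Radon_Nikodym_fin_num x nuQ.
have iR := Radon_Nikodym_integrable nuQ.
set f := Radon_Nikodym nu Q in fR iR *.
have mf := measurable_int _ iR.
have fE : EFin \o (fine \o f) = f by apply/funext => x /=; rewrite fineK.
have ifP : P.-integrable [set: T] (f : T -> \bar R).
  apply/integrableP; split; first by
    move=> _ B mB; apply: sG.2; rewrite -mE; exact: (mf measurableT B mB).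
  have /integrableP[_] := iR.
  rewrite ge0_integral_pushforward//.
  exact: measurable_int (integrable_abse iR).
exists (fine \o f); split.
- by apply/measurable_EFinP; rewrite fE.
- by rewrite fE.
- move=> A GA; have mA : measurable (A : set T') by rewrite mE.
  have := Radon_Nikodym_integral nuQ mA.
  rewrite integral_pushforward//=.
  + by move=> nuA; under eq_integral => x _ do rewrite fineK//; exact: esym nuA.
  + exact: (integrableS measurableT (sG.2 _ GA) (@subsetT _ A) ifP).
Qed.

Lemma cond_expP d (T : measurableType d) (R : realType)
    (P : probability T R) (G : set (set T)) (X : T -> R) :
  is_sub_sigma_algebra G -> P.-integrable [set: T] (EFin \o X) ->
  is_cond_exp P G X (cond_exp P G X).
Proof.
move=> sG iX; have := cond_exp_exists sG iX.
exact: (@xgetPex _ (cst 0) [set Z | is_cond_exp P G X Z]).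
Qed.

(* Main.v *)
(* Let A_{l,k} = E(S_{(k+1)2^l} - S_{k2^l} | F_{k2^l}) and
   W = |S_{2^r}| + sum_l max_k |A_{l,k}|.  Going from m to 2^r through dyadic blocks
   of increasing length, at most one per length, yields a variable T with |T| <= W
   and int_B S_m = int_B T for all B in F_m, hence int_B |S_m| <= int_B W.  Doob's
   argument then gives ||max_i |S_i|||_p <= q ||W||_p: with M_m = max_{i<=m} |S_i|,
   Young's inequality gives
     M_N^p <= q sum_m (M_m^(p-1) - M_{m-1}^(p-1)) |S_m|,
   where the weights are nonnegative and F_m-measurable, so that |S_m| may be replaced
   by W under the integral; the sum telescopes and Hoelder's inequality concludes.
   The bound for ||W||_p is Minkowski's inequality together with
   max_k |A_{l,k}|^p <= sum_k |A_{l,k}|^p. *)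

Require Import Defs.
From HB Require Import structures.
From mathcomp Require Import all_boot all_order all_algebra.
From mathcomp Require Import all_classical all_reals all_analysis.
From mathcomp Require Import measurable_realfun.
From mathcomp Require Import ring lra.

Import Order.TTheory GRing.Theory Num.Theory.
Import numFieldNormedType.Exports.

Local Open Scope classical_set_scope.
Local Open Scope ring_scope.

Set Implicit Arguments.
Unset Strict Implicit.
Unset Printing Implicit Defensive.

(** * Measurability with respect to a sub-sigma-algebra *)

Lemma measurable_wrt_preimage (R : realType) (d : measure_display)
    (Omega : measurableType d) (G : set (set Omega)) (X : Omega -> R)
    (B : set R) :
  is_sub_sigma_algebra G -> measurable_wrt G X -> measurable B ->
  G (X @^-1` B).
Proof.
move=> sG mX mB; rewrite -(sub_sigma_algebra_measurableE sG).
by have := mX measurableT _ mB; rewrite setTI.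
Qed.

Lemma measurable_wrt_measurable (R : realType) (d : measure_display)
    (Omega : measurableType d) (G : set (set Omega)) (X : Omega -> R) :
  is_sub_sigma_algebra G -> measurable_wrt G X ->
  measurable_fun [set: Omega] X.
Proof.
move=> sG mX _ B mB; rewrite setTI; apply: sG.2.
exact: measurable_wrt_preimage.
Qed.

Lemma measurable_wrtS (R : realType) (d : measure_display)
    (Omega : measurableType d) (G H : set (set Omega)) (X : Omega -> R) :
  is_sub_sigma_algebra G -> G `<=` H -> measurable_wrt G X ->
  measurable_wrt H X.
Proof.
move=> sG GH mX _ B mB; rewrite setTI.
suff: <<s H >> (X @^-1` B) by [].
by apply: sub_sigma_algebra; apply: GH; exact: measurable_wrt_preimage.
Qed.

(** * Comparison of integrals over the sets of a sub-sigma-algebra *)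

(** The set [B] is cut by the sign of [X] into two pieces, both in [G]. On each piece the integral
    of [|X|] is the absolute value of the integral of [X], which is that of [T], and the triangle
    inequality for integrals applies. *)
Lemma le_integral_norm_of_eq (R : realType) (d : measure_display)
    (Omega : measurableType d) (P : probability Omega R)
    (G : set (set Omega)) (X T : Omega -> R) :
  is_sub_sigma_algebra G -> measurable_wrt G X ->
  P.-integrable [set: Omega] (EFin \o X) ->
  P.-integrable [set: Omega] (EFin \o T) ->
  (forall A, G A ->
    (\int[P]_(x in A) (X x)%:E = \int[P]_(x in A) (T x)%:E)%E) ->
  forall B, G B ->
    (\int[P]_(x in B) `|X x|%:E <= \int[P]_(x in B) `|T x|%:E)%E.
Proof.
move=> sG mX iX iT XT B GB.
have GI A C : G A -> G C -> G (A `&` C).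
  rewrite -(sub_sigma_algebra_measurableE sG) => mA mC.
  exact: (@measurableI _ (g_sigma_algebraType G)).
have GpX : G (X @^-1` `[0, +oo[) by exact: measurable_wrt_preimage.
have GnX : G (X @^-1` `]-oo, 0[) by exact: measurable_wrt_preimage.
set Bp := B `&` (X @^-1` `[0, +oo[).
set Bn := B `&` (X @^-1` `]-oo, 0[).
have GBp : G Bp by exact: GI.
have GBn : G Bn by exact: GI.
have mG A : G A -> measurable A by move/sG.2.
have BE : B = Bp `|` Bn.
  rewrite -setIUr -preimage_setU (_ : _ `|` _ = setT) ?preimage_setT ?setIT//.
  apply/seteqP; split => // x _ /=; rewrite !in_itv/= andbT.
  by case: (leP 0 x); [left|right].
have dB : [disjoint Bp & Bn].
  apply/disj_setPS => x [[_ +] [_]]; rewrite /= !in_itv/= andbT => x0.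
  by rewrite ltNge x0.
have mTX : measurable_fun [set: Omega] X by exact: measurable_wrt_measurable mX.
have mTT : measurable_fun [set: Omega] T.
  by apply/measurable_EFinP; exact: measurable_int iT.
have mn (f : Omega -> R) D : measurable_fun [set: Omega] f ->
    measurable_fun D (fun x => `|f x|%:E).
  by move=> mf; apply/measurable_EFinP/measurableT_comp => //;
    exact: measurable_funTS.
rewrite BE !ge0_integral_setU//; try exact: mG; try exact: mn.
have le_abs C : G C ->
    (`|\int[P]_(x in C) (X x)%:E| <= \int[P]_(x in C) `|T x|%:E)%E.
  move=> GC; rewrite XT//; apply: le_abse_integral; first exact: mG.
  by apply/measurable_EFinP; exact: measurable_funTS.
apply: leeD; (apply: le_trans; last exact: le_abs).
- apply: le_trans (lee_abs _); rewrite le_eqVlt; apply/orP; left; apply/eqP.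
  apply: eq_integral => x; rewrite inE => -[_ /=].
  by rewrite in_itv/= andbT => x0; rewrite ger0_norm.
- rewrite -abseN; apply: le_trans (lee_abs _).
  rewrite -integralN; last first.
    apply: integrable_add_def; first exact: mG.
    exact: (integrableS measurableT (mG _ GBn) (@subsetT _ _) iX).
  rewrite le_eqVlt; apply/orP; left; apply/eqP.
  apply: eq_integral => x; rewrite inE => -[_ /=].
  by rewrite in_itv/= => x0; rewrite ltr0_norm.
Qed.

Section weighted_comparison.
Import HBNNSimple.

(** For a simple [h] whose level sets lie in [G], the claim is a nonnegative combination of the
    hypotheses on these sets. Monotone convergence extends it to every nonnegative [G]-measurable
    [h]. *)
Lemma le_integral_mul_of_le (R : realType) (d : measure_display)
    (Omega : measurableType d) (P : probability Omega R)
    (G : set (set Omega)) (U V h : Omega -> R) :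
  is_sub_sigma_algebra G ->
  measurable_fun [set: Omega] U -> measurable_fun [set: Omega] V ->
  (forall x, 0 <= U x) -> (forall x, 0 <= V x) ->
  (forall A, G A ->
    (\int[P]_(x in A) (U x)%:E <= \int[P]_(x in A) (V x)%:E)%E) ->
  measurable_wrt G h -> (forall x, 0 <= h x) ->
  (\int[P]_x (h x * U x)%:E <= \int[P]_x (h x * V x)%:E)%E.
Proof.
move=> sG mU mV U0 V0 UV mh h0.
(* The simple approximations of [h] are built on the space equipped with [G], so that their level
   sets belong to [G]. *)
pose T' := g_sigma_algebraType G.
have mEh : measurable_fun [set: T'] (EFin \o h : T' -> \bar R).
  exact/measurable_EFinP.
pose g n : Omega -> R := nnsfun_approx measurableT mEh n.
have g0 n x : 0 <= g n x by exact: fun_ge0.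
have Gmg n : measurable_wrt G (g n).
  exact: (measurable_funP (nnsfun_approx measurableT mEh n)).
have Gg n B : measurable B -> G (g n @^-1` B).
  by move=> mB; exact: measurable_wrt_preimage (Gmg n) mB.
have mg n : measurable_fun [set: Omega] (g n).
  exact: measurable_wrt_measurable (Gmg n).
have cvg_int (f : Omega -> R) : measurable_fun [set: Omega] f ->
    (forall x, 0 <= f x) ->
    (\int[P]_x (g n x * f x)%:E)%E @[n --> \oo] -->
    (\int[P]_x (h x * f x)%:E)%E.
  move=> mf f0.
  under [X in _ --> X]eq_integral => x _.
    rewrite (_ : (h x * f x)%:E = limn (fun n => (g n x * f x)%:E)); last first.
      apply/esym/cvg_lim => //; apply: cvg_EFin; first exact: nearW.
      apply: cvgMl.
      have := @cvg_nnsfun_approx _ _ _ _ measurableT _ mEh (fun x _ => h0 x) x I.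
      by move/fine_cvg.
    over.
  apply: cvg_monotone_convergence => //.
  - by move=> n; apply/measurable_EFinP/measurable_funM.
  - by move=> n x _; rewrite lee_fin mulr_ge0.
  - move=> x _ m n mn; rewrite lee_fin ler_wpM2r//.
    by have /lefP := nd_nnsfun_approx measurableT mEh mn; apply.
have fg n : finite_set (range (g n)).
  exact: (@fimfunP _ _ (nnsfun_approx measurableT mEh n)).
(* The values [y] of [g n] are nonnegative; writing [|y|] makes the summand nonnegative for every
   real [y], as the exchange of sum and integral asks. *)
have int_g n (f : Omega -> R) : measurable_fun [set: Omega] f ->
    (forall x, 0 <= f x) ->
    (\int[P]_x (g n x * f x)%:E =
     \sum_(y \in range (g n))
       (`|y|%:E * \int[P]_(x in g n @^-1` [set y]) (f x)%:E))%E.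
  move=> mf f0.
  have mgy y : measurable (g n @^-1` [set y]).
    by have := mg n measurableT _ (measurable_set1 y); rewrite setTI.
  have m1f y : measurable_fun [set: Omega]
      (fun x => (\1_(g n @^-1` [set y]) x * f x)%:E).
    by apply/measurable_EFinP/measurable_funM => //;
      exact/measurable_indic/mgy.
  transitivity (\int[P]_x (\sum_(y \in range (g n))
      (`|y| * (\1_(g n @^-1` [set y]) x * f x))%:E))%E.
    apply: eq_integral => x _; rewrite fsumEFin//; congr EFin.
    rewrite (fsbigD1 (g n x))// indicE mem_set// mul1r fsbig1.
      by rewrite /= addr0 ger0_norm.
    by move=> y [_ /= /nesym yx]; rewrite indicE memNset// mul0r mulr0.
  rewrite ge0_integral_fsum//.
  - apply: eq_fsbigr => y _; under eq_integral do rewrite EFinM.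
    rewrite ge0_integralZl_EFin//.
    + congr (_ * _)%E; rewrite [RHS]integral_mkcond; apply: eq_integral => x _.
      by rewrite patchE indicE; case: ifP; rewrite ?mul1r ?mul0r.
    + by move=> x _; rewrite lee_fin mulr_ge0// indicE.
  - by move=> y; under eq_fun do rewrite EFinM; exact: measurable_funeM.
  - by move=> y x _; rewrite lee_fin !mulr_ge0.
apply: lee_cvg_to (cvg_int U mU U0) (cvg_int V mV V0) _.
apply: nearW => n; rewrite !int_g//; apply: lee_fsum => //.
by move=> y _; rewrite lee_wpmul2l ?lee_fin//; apply/UV/Gg.
Qed.

End weighted_comparison.

(** * Running maxima and Doob's maximal inequality *)

(** Young's inequality gives b a^(p-1) <= b^p / p + a^p / q, because (p-1) q = p. Multiplying by [q]
    and using q / p = q - 1 yields the claim. *)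
Lemma powR_increment_le (R : realType) (p q a b : R) :
  1 < p -> q = p / (p - 1) -> 0 <= a -> 0 <= b ->
  b `^ p - a `^ p <= q * ((b `^ (p - 1) - a `^ (p - 1)) * b).
Proof.
move=> p1 qE a0 b0.
have p0 : 0 < p by lra.
have p10 : 0 < p - 1 by lra.
have q0 : 0 < q by rewrite qE divr_gt0.
have pq : p^-1 + q^-1 = 1 by rewrite qE; field; lra.
have := conjugate_powR b0 (powR_ge0 a (p - 1)) p0 q0 pq.
rewrite -powRrM (_ : (p - 1) * q = p); last by rewrite qE; field; lra.
rewrite -(ler_pM2l q0) => young.
have qp : q / p = q - 1 by rewrite qE; field; lra.
rewrite mulrBl [_ * b]mulrC mulr_powRB1// [_ * b]mulrC mulrBr.
rewrite [X in _ <= X](_ : _ = q * b `^ p - q * (b * a `^ (p - 1)))//.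
move: young; rewrite mulrDr !mulrA [q * _ / p]mulrAC [q * _ / q]mulrAC.
by rewrite qp divff ?gt_eqF// -!mulrA; lra.
Qed.

(** Starting the maximum at 0 is harmless for absolute values, and the value 0 at [m = 0] lets the
    telescoping sums start from nothing. *)
Definition running_max (R : realType) (T : Type) (X : nat -> T -> R) (m : nat) :
    T -> R :=
  fun w => \big[Num.max/0]_(1 <= i < m.+1) `|X i w|.

Section running_max.
Context (R : realType) (T : Type).
Implicit Type X : nat -> T -> R.

Lemma running_max0 X w : running_max X 0 w = 0.
Proof. by rewrite /running_max big_geq. Qed.

(* [big_nat_recr] does not apply: [0] is not neutral for [Num.max] on [R]. *)
Lemma running_maxS X m w :
  running_max X m.+1 w = Num.max (running_max X m w) `|X m.+1 w|.
Proof.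
rewrite /running_max /index_iota !subn1 !succnK -[in LHS](addn1 m) iotaD add1n.
elim: (iota 1 m) => [|i s ih]; first by rewrite !big_cons big_nil maxC.
by rewrite !big_cons ih maxA.
Qed.

Lemma running_max_ge0 X m w : 0 <= running_max X m w.
Proof.
elim: m => [|m ih]; first by rewrite running_max0.
by rewrite running_maxS le_max ih.
Qed.

(** Telescoping: an increment of the maximum vanishes unless the new maximum is [|X i.+1 w|] itself,
    and then [powR_increment_le] applies with this value as [b]. *)
Lemma running_max_powR_le X (p q : R) m w :
  1 < p -> q = p / (p - 1) ->
  running_max X m w `^ p <=
  q * \sum_(i < m)
    (running_max X i.+1 w `^ (p - 1) - running_max X i w `^ (p - 1)) *
    `|X i.+1 w|.
Proof.
move=> p1 qE; elim: m => [|m ih].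
  by rewrite running_max0 big_ord0 mulr0 powR0// gt_eqF//; lra.
rewrite big_ord_recr/= mulrDr -[leLHS](subrK (running_max X m w `^ p)) addrC.
apply: lerD => //; rewrite running_maxS; case: (leP _ `|X m.+1 w|) => _.
  exact: powR_increment_le (running_max_ge0 _ _ _) (normr_ge0 _).
by rewrite !subrr mul0r mulr0.
Qed.

End running_max.

Lemma measurable_running_max (R : realType) (d : measure_display)
    (T : measurableType d) (X : nat -> T -> R) (m : nat) :
  (forall i, (1 <= i <= m)%N -> measurable_fun [set: T] (X i)) ->
  measurable_fun [set: T] (running_max X m).
Proof.
elim: m => [_|m ih mX].
  rewrite (_ : running_max X 0 = cst 0); first exact: measurable_cst.
  by apply/funext => w; rewrite running_max0.
rewrite (_ : running_max X m.+1 =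
    (running_max X m) \max (fun w => `|X m.+1 w|)); last first.
  by apply/funext => w; rewrite running_maxS.
apply: measurable_maxr.
  by apply: (ih _) => i /andP[i1 im]; apply: (mX i _); rewrite i1 leqW.
by apply: measurableT_comp => //; apply: (mX m.+1 _); rewrite ltnSn.
Qed.

Lemma LnormE (R : realType) (d : measure_display) (Omega : measurableType d)
    (P : probability Omega R) (p : R) (f : Omega -> R) :
  ('N[P]_p%:E[EFin \o f] = (\int[P]_w (`|f w| `^ p)%:E) `^ p^-1)%E.
Proof. by rewrite unlock. Qed.

(** The comparison of [|X i|] with [W] over the sets of [F i] replaces the submartingale property.
    Finiteness of the norm of the maximum permits the final division by its power p - 1. *)
Lemma doob_maximal_inequality (R : realType) (d : measure_display)
    (Omega : measurableType d) (P : probability Omega R) (p q : R)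
    (F : nat -> set (set Omega)) (X : nat -> Omega -> R) (W : Omega -> R)
    (N : nat) :
  1 < p -> q = p / (p - 1) -> is_filtration F ->
  (forall i, (1 <= i <= N)%N -> measurable_wrt (F i) (X i)) ->
  measurable_fun [set: Omega] W -> (forall w, 0 <= W w) ->
  (forall i A, (1 <= i <= N)%N -> F i A ->
    (\int[P]_(w in A) `|X i w|%:E <= \int[P]_(w in A) (W w)%:E)%E) ->
  ('N[P]_p%:E[EFin \o running_max X N] < +oo)%E ->
  ('N[P]_p%:E[EFin \o running_max X N] <=
   q%:E * 'N[P]_p%:E[EFin \o W])%E.
Proof.
move=> p1 qE [sF ndF] aX mW W0 XW Mfin.
have p0 : 0 < p by lra.
have p10 : 0 < p - 1 by lra.
have q0 : 0 < q by rewrite qE divr_gt0.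
have pq : q^-1 + p^-1 = 1 by rewrite qE; field; lra.
have pm1q : (p - 1) * q = p by rewrite qE; field; lra.
pose M := running_max X.
(* The weight of [|X i.+1|]: it depends on the maximum up to [i.+1], hence is measurable for
   [F i.+1], where [X i.+1] can be compared with [W]. *)
pose H i w := M i.+1 w `^ (p - 1) - M i w `^ (p - 1).
have M0 i w : 0 <= M i w by exact: running_max_ge0.
have H0 i w : 0 <= H i w.
  rewrite subr_ge0; apply: ge0_ler_powR; rewrite ?nnegrE//; first exact: ltW.
  by rewrite /M running_maxS le_max lexx.
have aM i j : (i <= j)%N -> (j <= N)%N -> measurable_wrt (F j) (M i).
  (* Measurability of the maximum is used here on the space equipped with the sigma-algebra
     [F j]. *)
  move=> ij jN; apply: measurable_running_max => k /andP[k1 ki].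
  apply: (@measurable_wrtS _ _ _ (F k)) => //.
    by apply: ndF; exact: leq_trans ij.
  by apply: aX; rewrite k1 (leq_trans ki)// (leq_trans ij).
have aH i : (i < N)%N -> measurable_wrt (F i.+1) (H i).
  move=> iN; apply: measurable_funB.
    by apply: measurableT_comp (measurable_powR _) _; exact: aM.
  by apply: measurableT_comp (measurable_powR _) _; apply: aM.
have mX i : (1 <= i <= N)%N -> measurable_fun [set: Omega] (X i).
  by move=> iN; apply: measurable_wrt_measurable (aX i iN).
have mM : measurable_fun [set: Omega] (M N) by exact: measurable_running_max.
have mH i : (i < N)%N -> measurable_fun [set: Omega] (H i).
  by move=> iN; apply: measurable_wrt_measurable (aH i iN).
have Mpm1 w : M N w `^ (p - 1) = \sum_(i < N) H i w.
  have -> : M N w `^ (p - 1) = M N w `^ (p - 1) - M 0%N w `^ (p - 1).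
    by rewrite /M running_max0 powR0 ?subr0// gt_eqF.
  by rewrite -(big_mkord xpredT (fun i => H i w)) telescope_sumr.
have mHX i : (i < N)%N -> measurable_fun [set: Omega]
    (fun w => H i w * `|X i.+1 w|).
  move=> iN; apply: measurable_funM; first exact: mH.
  by apply: measurableT_comp => //; apply: (mX i.+1); rewrite iN.
have mHW i : (i < N)%N -> measurable_fun [set: Omega] (fun w => H i w * W w).
  by move=> iN; apply: measurable_funM => //; exact: mH.
have step : (\int[P]_w (M N w `^ p)%:E <=
    q%:E * \int[P]_w (M N w `^ (p - 1) * W w)%:E)%E.
  apply: (@le_trans _ _
      (\int[P]_w (q * \sum_(i < N) H i w * `|X i.+1 w|)%:E)%E).
    apply: ge0_le_integral => //.
    - by move=> w _; rewrite lee_fin powR_ge0.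
    - by apply/measurable_EFinP; apply: measurableT_comp (measurable_powR _) _.
    - apply/measurable_EFinP/measurable_funM => //.
      by apply: measurable_sum => i; exact: mHX.
    - by move=> w _; rewrite lee_fin; exact: running_max_powR_le.
  under eq_integral do rewrite EFinM.
  rewrite ge0_integralZl_EFin//; last 3 first.
  - by move=> w _; rewrite lee_fin sumr_ge0// => i _; rewrite mulr_ge0.
  - by apply/measurable_EFinP/measurable_sum => i; exact: mHX.
  - exact: ltW.
  under eq_integral do rewrite -sumEFin.
  (* The power p - 1 of the maximum is expanded back into the weights [H i], so that both sides can
     be compared term by term. *)
  under [X in (_ <= _ * X)%E]eq_integral do
    rewrite Mpm1 mulr_suml -sumEFin.
  rewrite lee_pmul2l// !ge0_integral_sum//.
  - apply: lee_sum => i _.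
    apply: (le_integral_mul_of_le (sF i.+1)) => //.
    + by apply: measurableT_comp => //; apply: (mX i.+1); rewrite ltn_ord.
    + by move=> A FA; apply: XW => //; rewrite ltn_ord.
    + exact: aH.
  - by move=> i; apply/measurable_EFinP; exact: mHW.
  - by move=> i w _; rewrite lee_fin mulr_ge0.
  - by move=> i; apply/measurable_EFinP; exact: mHX.
  - by move=> i w _; rewrite lee_fin mulr_ge0.
(* Since (p-1) q = p, the L^q norm of the power p - 1 of the maximum is the integral of its p-th
   power to the power 1/q. *)
have hol : (\int[P]_w (M N w `^ (p - 1) * W w)%:E <=
    (\int[P]_w (M N w `^ p)%:E) `^ q^-1 * 'N[P]_p%:E[EFin \o W])%E.
  have mMp : measurable_fun [set: Omega] (fun w => M N w `^ (p - 1)).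
    by apply: measurableT_comp (measurable_powR _) _.
  have := hoelder P mMp mW q0 p0 pq.
  rewrite Lnorm1 LnormE.
  under eq_integral do rewrite /= ger0_norm ?mulr_ge0 ?powR_ge0//.
  under [X in (_ <= X `^ _ * _)%E -> _]eq_integral do
    rewrite /= ger0_norm ?powR_ge0// -powRrM pm1q.
  by [].
have MpE : ('N[P]_p%:E[EFin \o M N] = (\int[P]_w (M N w `^ p)%:E) `^ p^-1)%E.
  rewrite LnormE; congr (_ `^ _)%E; apply: eq_integral => w _ /=.
  by rewrite ger0_norm.
move: Mfin; rewrite MpE => Mfin.
have : (\int[P]_w (M N w `^ p)%:E < +oo)%E.
  by apply: lty_poweRy Mfin; rewrite invr_neq0// gt_eqF.
have : (0 <= \int[P]_w (M N w `^ p)%:E)%E.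
  by apply: integral_ge0 => w _; rewrite lee_fin powR_ge0.
move: step hol; case: (\int[P]_w (M N w `^ p)%:E)%E => // a step hol.
rewrite lee_fin le_eqVlt => /predU1P[<- _|a0 _].
  rewrite poweR_EFin powR0 ?invr_neq0 ?gt_eqF// mule_ge0 ?Lnorm_ge0//.
  by rewrite lee_fin ltW.
(* Multiplying by the positive finite factor a^(1/q) turns the left side into [a], as 1/q + 1/p = 1;
   [step] and [hol] then conclude. *)
rewrite -(@lee_pmul2l _ (a `^ q^-1)%:E)// ?lte_fin ?powR_gt0//.
rewrite poweR_EFin -EFinM -powRD ?pq ?oner_eq0//= powRr1 ?(ltW a0)//.
by apply: (le_trans step); rewrite muleCA lee_pmul2l.
Qed.

(** * Norms of maxima and of sums *)

Lemma running_max_ge (R : realType) (T : Type) (X : nat -> T -> R) (m k : nat)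
    (w : T) :
  (1 <= k <= m)%N -> `|X k w| <= running_max X m w.
Proof.
elim: m => [|m ih] /andP[k1 km]; first by move: k1; rewrite ltnNge km.
rewrite running_maxS le_max; move: km; rewrite leq_eqVlt => /predU1P[->|km].
  by rewrite lexx orbT.
by rewrite ih ?k1.
Qed.

Lemma running_max_powR_le_sum (R : realType) (T : Type) (X : nat -> T -> R)
    (p : R) (m : nat) (w : T) :
  0 < p ->
  running_max X m w `^ p <= \sum_(1 <= k < m.+1) `|X k w| `^ p.
Proof.
move=> p0; elim: m => [|m ih].
  by rewrite running_max0 big_geq// powR0// gt_eqF.
rewrite running_maxS big_nat_recr//=; case: (leP _ `|X m.+1 w|) => _.
  by rewrite lerDr sumr_ge0// => i _; exact: powR_ge0.
by rewrite (le_trans ih)// lerDl powR_ge0.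
Qed.

(** Serves twice: to bound each [dyadic_drift_max], and to see that the maximum of the partial sums
    has finite norm before Doob's inequality is applied. *)
Lemma Lnorm_running_max_le (R : realType) (d : measure_display)
    (Omega : measurableType d) (P : probability Omega R) (p : R)
    (X : nat -> Omega -> R) (m : nat) :
  0 < p ->
  (forall k, (1 <= k <= m)%N -> measurable_fun [set: Omega] (X k)) ->
  ('N[P]_p%:E[EFin \o running_max X m] <=
   (\sum_(1 <= k < m.+1) 'N[P]_p%:E[EFin \o X k] `^ p) `^ p^-1)%E.
Proof.
move=> p0 mX; have pN0 : p != 0 by rewrite gt_eqF.
have mXp (k : 'I_m) :
    measurable_fun [set: Omega] (fun w => (`|X k.+1 w| `^ p)%:E).
  apply/measurable_EFinP; apply: measurableT_comp (measurable_powR _) _.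
  by apply: measurableT_comp => //; apply: (mX k.+1); rewrite ltn_ord.
rewrite LnormE; apply: gt0_ler_poweR.
- by rewrite invr_ge0 ltW.
- by rewrite in_itv/= leey andbT integral_ge0// => w _; rewrite lee_fin powR_ge0.
- by rewrite in_itv/= leey andbT sume_ge0// => k _; exact: poweR_ge0.
rewrite big_add1 big_mkord.
under [X in (_ <= X)%E]eq_bigr do rewrite poweR_Lnorm//.
rewrite /= -ge0_integral_sum//.
apply: ge0_le_integral => //.
- apply/measurable_EFinP; apply: measurableT_comp (measurable_powR _) _.
  by apply: measurableT_comp => //; exact: measurable_running_max.
- by apply: emeasurable_sum => k; exact: mXp.
move=> w _; rewrite sumEFin lee_fin ger0_norm ?running_max_ge0//.
have := running_max_powR_le_sum X m w p0.
by rewrite big_add1 big_mkord.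
Qed.

Lemma Lnorm_sum_le (R : realType) (d : measure_display)
    (Omega : measurableType d) (P : probability Omega R) (p : R)
    (f : nat -> Omega -> R) (n : nat) :
  1 <= p -> (forall i, (i < n)%N -> measurable_fun [set: Omega] (f i)) ->
  ('N[P]_p%:E[EFin \o (fun w => \sum_(0 <= i < n) f i w)%R] <=
   \sum_(0 <= i < n) 'N[P]_p%:E[EFin \o f i])%E.
Proof.
move=> p1; elim: n => [mf|n ih mf].
  rewrite [leRHS]big_geq// LnormE.
  under eq_integral do
    rewrite big_geq// normr0 powR0 ?gt_eqF// ?(lt_le_trans ltr01)//.
  by rewrite integral0 poweR0r// invr_neq0// gt_eqF// (lt_le_trans ltr01).
rewrite [leRHS]big_nat_recr//=.
rewrite (_ : (fun w => _) = (fun w => \sum_(0 <= i < n) f i w) \+ f n); last first.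
  by apply/funext => w; rewrite big_nat_recr.
have mfn i : (i < n)%N -> measurable_fun [set: Omega] (f i).
  by move=> /ltnW; exact: mf.
apply: le_trans (minkowski_EFin P _ _ p1) _ => //.
- rewrite (_ : (fun w => _) = (fun w => \sum_(i < n) f i w)); last first.
    by apply/funext => w; rewrite big_mkord.
  by apply: measurable_sum => i; exact: mfn.
- exact: mf.
by rewrite leeD2r// ih.
Qed.

(** * Dyadic blocks and their conditional drifts *)

Section dyadic.
Context (R : realType) (d : measure_display) (Omega : measurableType d)
  (P : probability Omega R) (F : nat -> set (set Omega)) (r : nat)
  (S : nat -> Omega -> R).
Hypothesis hF : is_filtration F.
Hypothesis iS : forall m, (m <= 2 ^ r)%N ->
  P.-integrable [set: Omega] (EFin \o S m).

(** The A_{l,k} of the overview. *)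
Definition dyadic_drift (l k : nat) : Omega -> R :=
  cond_exp P (F (k * 2 ^ l)%N) (S ((k + 1) * 2 ^ l)%N \- S (k * 2 ^ l)%N).

Definition dyadic_drift_max (l : nat) : Omega -> R :=
  running_max (dyadic_drift l) (2 ^ (r - l)).-1.

(** The bound on [k] keeps the end (k+1) 2^l of the block within 2^r, where [S] is integrable. *)
Lemma dyadic_driftP (l k : nat) : (l <= r)%N -> (k <= (2 ^ (r - l)).-1)%N ->
  is_cond_exp P (F (k * 2 ^ l)%N)
    (S ((k + 1) * 2 ^ l)%N \- S (k * 2 ^ l)%N) (dyadic_drift l k).
Proof.
move=> lr kr; have le2r i : (i <= 2 ^ (r - l))%N -> (i * 2 ^ l <= 2 ^ r)%N.
  by move=> ir; rewrite -(subnK lr) expnD leq_pmul2r ?expn_gt0.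
have kS : (k + 1 <= 2 ^ (r - l))%N by rewrite addn1 -ltnS prednK ?expn_gt0 in kr *.
apply: cond_expP; first exact: hF.1.
rewrite (_ : EFin \o _ = (EFin \o S ((k + 1) * 2 ^ l)%N) \-
  (EFin \o S (k * 2 ^ l)%N))%E//.
by apply: integrableB => //; apply/iS/le2r => //; rewrite (leq_trans _ kS)// leq_addr.
Qed.

(* If [k] is even, [k * 2 ^ l] is already a multiple of [2 ^ l.+1]; if [k] is odd, one
   block of length [2 ^ l] leads to the next multiple, which explains the single
   drift term per level. *)
Lemma dyadic_representation (j l k : nat) :
  (l + j = r)%N -> (1 <= k <= 2 ^ j)%N ->
  exists T : Omega -> R,
    [/\ P.-integrable [set: Omega] (EFin \o T),
        forall w, `|T w| <=
          `|S (2 ^ r)%N w| + \sum_(l <= i < r) dyadic_drift_max i w &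
        forall B, F (k * 2 ^ l)%N B ->
          (\int[P]_(w in B) (S (k * 2 ^ l)%N w)%:E =
           \int[P]_(w in B) (T w)%:E)%E].
Proof.
(* Induction on the number [j] of levels still to climb; at [j = 0] the only position is 2^r
   itself. *)
elim: j l k => [|j ih] l k ljr /andP[k1 kj].
  have -> : k = 1%N by apply/eqP; rewrite eqn_leq k1 andbT.
  exists (S (2 ^ r)%N); split; first exact: iS.
  - by move=> w; rewrite lerDl sumr_ge0// => i _; exact: running_max_ge0.
  - by move=> B _; rewrite mul1n -ljr addn0.
have lr : (l < r)%N by rewrite -ljr addnS ltnS leq_addr.
have l1jr : (l.+1 + j = r)%N by rewrite addSnnS.
have rl : (r - l = j.+1)%N by rewrite -ljr addKn.
have drift_max0 w : 0 <= dyadic_drift_max l w by exact: running_max_ge0.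
have [ek|ok] := boolP (odd k); last first.
  have kE : k = (k./2 * 2)%N by rewrite muln2 even_halfK.
  have [|T [iT bT eT]] := ih l.+1 k./2 l1jr.
    rewrite half_gt0 leq_half_double -mul2n -expnS leqW// andbT.
    by case: k k1 ok {kj kE} => [|[]].
  have mE : (k./2 * 2 ^ l.+1 = k * 2 ^ l)%N by rewrite expnS mulnA -kE.
  exists T; split => //; last by rewrite -mE.
  move=> w; apply: le_trans (bT w) _; rewrite lerD2l [leRHS]big_ltn//.
  by rewrite lerDr.
have kE : (k + 1 = k.+1./2 * 2)%N by rewrite addn1 muln2 even_halfK//= ek.
(* An odd [k] cannot equal the even number 2^(j+1), so the next block still ends within 2^r. *)
have kj' : (k < 2 ^ j.+1)%N.
  rewrite ltn_neqAle kj andbT; apply: contraTneq ek => ->.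
  by rewrite expnS mul2n odd_double.
have [|T [iT bT eT]] := ih l.+1 k.+1./2 l1jr.
  by rewrite half_gt0 leq_half_double -mul2n -expnS ltnS k1.
have mE : (k.+1./2 * 2 ^ l.+1 = (k + 1) * 2 ^ l)%N by rewrite expnS mulnA -kE.
have kr : (k <= (2 ^ (r - l)).-1)%N by rewrite rl -ltnS prednK ?expn_gt0.
have [mA iA eA] := dyadic_driftP (ltnW lr) kr.
(* [T] represents the sum at the end of the block; going back to its start subtracts the block's
   increment, which has the same integral over [B] as its conditional expectation. *)
exists (T \- dyadic_drift l k); split.
- rewrite (_ : EFin \o _ = (EFin \o T) \- (EFin \o dyadic_drift l k))%E//.
  exact: integrableB.
- move=> w; apply: le_trans (ler_normB _ _) _; rewrite big_ltn// addrCA addrC.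
  apply: lerD; first exact: bT.
  by apply: running_max_ge; rewrite k1.
move=> B FB.
have mB : measurable B by exact: (hF.1 _).2 _ FB.
have le2r i : (i <= 2 ^ (r - l))%N -> (i * 2 ^ l <= 2 ^ r)%N.
  by move=> ir; rewrite -(subnK (ltnW lr)) expnD leq_pmul2r ?expn_gt0.
have iB (f : Omega -> R) : P.-integrable [set: Omega] (EFin \o f) ->
    P.-integrable B (EFin \o f).
  exact: integrableS.
have iSk : P.-integrable B (EFin \o S (k * 2 ^ l)%N).
  by apply/iB/iS/le2r; rewrite rl.
have iSk1 : P.-integrable B (EFin \o S ((k + 1) * 2 ^ l)%N).
  by apply/iB/iS/le2r; rewrite rl addn1.
have FB' : F (k.+1./2 * 2 ^ l.+1)%N B.
  by apply: hF.2 FB; rewrite mE leq_pmul2r ?expn_gt0// leq_addr.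
rewrite integralB_EFin//; try exact: iB.
rewrite -eT// eA// mE integralB_EFin//.
(* Both integrals are finite, so the cancellation can be done in the reals. *)
rewrite -(fineK (integrable_fin_num mB iSk)).
rewrite -(fineK (integrable_fin_num mB iSk1)).
by rewrite -!EFinB; congr EFin; ring.
Qed.

End dyadic.

(** * Partial sums and the final inequality *)

Lemma measurable_wrt_partial_sum (R : realType) (d : measure_display)
    (Omega : measurableType d) (F : nat -> set (set Omega))
    (Y : nat -> Omega -> R) (m : nat) :
  is_filtration F ->
  (forall i, (1 <= i <= m)%N -> measurable_wrt (F i) (Y i)) ->
  measurable_wrt (F m) (partial_sum Y m).
Proof.
move=> [sF ndF] aY.
rewrite (_ : partial_sum Y m = fun w => \sum_(i < m) Y i.+1 w); last first.
  by apply/funext => w; rewrite /partial_sum big_add1 big_mkord.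
apply: measurable_sum => i; apply: (measurable_wrtS (sF i.+1)).
  by apply: ndF.
by apply: aY; rewrite ltn_ord.
Qed.

Lemma partial_sum_Lfun (R : realType) (d : measure_display)
    (Omega : measurableType d) (P : probability Omega R) (p : \bar R)
    (Y : nat -> Omega -> R) (m : nat) :
  (1 <= p)%E -> (forall i, (1 <= i <= m)%N -> Y i \in Lfun P p) ->
  partial_sum Y m \in Lfun P p.
Proof.
move=> p1; elim: m => [|m ih] YL.
  rewrite (_ : partial_sum Y 0 = 0); first exact: (Lfun_addr_closed P p1).1.
  by apply/funext => w; rewrite /partial_sum big_geq.
rewrite (_ : partial_sum Y m.+1 = partial_sum Y m + Y m.+1); last first.
  by apply/funext => w; rewrite /partial_sum big_nat_recr.
apply: (Lfun_addr_closed P p1).2; last by apply: YL; rewrite ltnSn.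
by apply: ih => i /andP[i1 im]; apply: YL; rewrite i1 leqW.
Qed.

Unset Implicit Arguments.

Theorem proposition2 (R : realType) (d : measure_display)
    (Omega : measurableType d) (P : probability Omega R)
    (p q : R) (hp : 1 < p) (hq : q = p / (p - 1))
    (r : nat) (hr : (0 < r)%N)
    (F : nat -> set (set Omega)) (hF : is_filtration F)
    (Y : nat -> Omega -> R)
    (hLp : forall i : nat, (1 <= i <= 2 ^ r)%N -> Y i \in Lfun P p%:E)
    (hadapted : forall i : nat, (1 <= i <= 2 ^ r)%N ->
      measurable_wrt (F i) (Y i)) :
  let S := partial_sum Y in
  ('N[P]_(p%:E)[EFin \o
      (fun w => \big[Num.max/0%R]_(1 <= i < (2 ^ r).+1) `|S i w|%R)] <=
   q%:E * 'N[P]_(p%:E)[EFin \o S (2 ^ r)%N] +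
   q%:E * \sum_(0 <= l < r)
     (\sum_(1 <= k < 2 ^ (r - l))
        'N[P]_(p%:E)[EFin \o
          cond_exp P (F (k * 2 ^ l)%N)
            (S ((k + 1) * 2 ^ l)%N \- S (k * 2 ^ l)%N)%R] `^ p) `^ p^-1)%E.
Proof.
cbv zeta; set S := partial_sum Y.
have p0 : 0 < p by lra.
have q0 : 0 < q by rewrite hq divr_gt0//; lra.
have p1e : (1 <= p%:E)%E by rewrite lee_fin ltW.
have aS m : (m <= 2 ^ r)%N -> measurable_wrt (F m) (S m).
  move=> mr; apply: measurable_wrt_partial_sum => // i /andP[i1 im].
  by apply: hadapted; rewrite i1 (leq_trans im).
have LpS m : (m <= 2 ^ r)%N -> S m \in Lfun P p%:E.
  move=> mr; apply: partial_sum_Lfun => // i /andP[i1 im].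
  by apply: hLp; rewrite i1 (leq_trans im).
have iS m : (m <= 2 ^ r)%N -> P.-integrable [set: Omega] (EFin \o S m).
  move=> mr; apply/Lfun1_integrable.
  apply: (Lfun_subset (lexx 1%E) p1e _ p1e); last exact: LpS.
  exact: (fin_num_measure P _ measurableT).
have mS m : (m <= 2 ^ r)%N -> measurable_fun [set: Omega] (S m).
  by move=> mr; apply/measurable_EFinP; exact: measurable_int (iS m mr).
pose D := dyadic_drift P F S.
pose Z := dyadic_drift_max P F r S.
have mD l k : (l < r)%N -> (1 <= k <= (2 ^ (r - l)).-1)%N ->
    measurable_fun [set: Omega] (D l k).
  move=> lr /andP[_ kr]; have [_ iD _] := dyadic_driftP hF iS (ltnW lr) kr.
  by apply/measurable_EFinP; exact: measurable_int iD.
have mZ l : (l < r)%N -> measurable_fun [set: Omega] (Z l).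
  by move=> lr; apply: measurable_running_max => k kr; exact: mD.
pose Zs w := \sum_(0 <= l < r) Z l w.
have mZs : measurable_fun [set: Omega] Zs.
  rewrite (_ : Zs = fun w => \sum_(l < r) Z l w); last first.
    by apply/funext => w; rewrite /Zs big_mkord.
  by apply: measurable_sum => l; exact: mZ.
have mSN : measurable_fun [set: Omega] (fun w => `|S (2 ^ r)%N w|).
  by apply: measurableT_comp => //; exact: mS.
have Zs0 w : 0 <= Zs w.
  by apply: sumr_ge0 => l _; exact: running_max_ge0.
pose W := (fun w => `|S (2 ^ r)%N w|) \+ Zs.
have doob : ('N[P]_p%:E[EFin \o running_max S (2 ^ r)] <=
    q%:E * 'N[P]_p%:E[EFin \o W])%E.
  apply: (doob_maximal_inequality hp hq hF).
  - by move=> i /andP[_ ir]; exact: aS.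
  - exact: measurable_funD.
  - by move=> w; rewrite addr_ge0.
  - move=> i A /andP[i1 ir] FA.
    have [T [iT TW eT]] : exists T : Omega -> R,
        [/\ P.-integrable [set: Omega] (EFin \o T),
            forall w, `|T w| <= W w &
            forall B, F i B -> (\int[P]_(w in B) (S i w)%:E =
                                \int[P]_(w in B) (T w)%:E)%E].
      (* Start at level 0 with all [r] levels to climb: there the position [i] is its own multiple
         of 2^0 and the bound is [W]. *)
      have := @dyadic_representation _ _ _ P _ _ _ hF iS r 0 i (add0n r).
      by rewrite i1 ir expn0 muln1; apply.
    apply: (le_trans (le_integral_norm_of_eq (hF.1 i) (aS i ir) (iS i ir) iT eT FA)).
    have mA : measurable A by exact: (hF.1 i).2.
    apply: ge0_le_integral => //.
    + apply/measurable_EFinP/measurable_funTS/measurableT_comp => //.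
      by apply/measurable_EFinP; exact: measurable_int iT.
    + by apply/measurable_EFinP/measurable_funTS/measurable_funD.
    + by move=> w _; rewrite lee_fin.
  - apply: (le_lt_trans (Lnorm_running_max_le P p0 _)).
      by move=> k /andP[_ kr]; exact: mS.
    rewrite big_add1 big_mkord; apply/poweR_lty/lte_sum_pinfty => k _.
    apply: poweR_lty; exact: set_mem (sub_Lfun_finLfun (LpS k.+1 (ltn_ord k))).
(* The maximum in the goal unfolds from [running_max S (2 ^ r)]; the two terms on the right share
   the factor [q]. *)
apply: (le_trans doob); rewrite -ge0_muleDr ?Lnorm_ge0//; last first.
  by apply: sume_ge0 => l _; exact: poweR_ge0.
rewrite lee_pmul2l//.
apply: le_trans (minkowski_EFin P mSN mZs (ltW hp)) _.
apply: leeD.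
  by rewrite !LnormE; under eq_integral do rewrite normr_id.
apply: le_trans (Lnorm_sum_le P (ltW hp) mZ) _.
rewrite !big_mkord; apply: lee_sum => l _.
apply: (le_trans (Lnorm_running_max_le P p0 _)); first by move=> k; exact: mD.
(* The maximum runs over k <= 2^(r-l) - 1, which is the range k < 2^(r-l) of the goal. *)
by rewrite prednK ?expn_gt0.
Qed.
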